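(* Let $A$ be a complete discrete valuation ring in which $2$ is a unit, with maximal ideal $\mathfrak r$ and an involution $*$. Let $B$ be the fixed field of the involution induced by $*$ on $A/\mathfrak r$, and suppose that the norm map $\mathcal N:A/\mathfrak r\to B$, $a+\mathfrak r\mapsto aa^*+\mathfrak r$, is surjective. Let $\varepsilon\in\{1,-1\}$, let $V$ and $V'$ be free $A$-modules, both of rank $m>0$, and let $h:V\times V\to A$ and $h':V'\times V'\to A$ be $\varepsilon$-hermitian forms (possibly degenerate). Then $h$ and $h'$ are equivalent if and only if $d_i=d'_i$ for all $i\ge0$.
   Context: An involution of $A$ is a ring automorphism $a\mapsto a^*$ of order at most two (the identity is allowed). Complete means that $\bigcap_{i\ge1}\mathfrak r^i=0$ and $A$ is complete for its $\mathfrak r$-adic metric. A map $h:V\times V\to A$ is an $\varepsilon$-hermitian form if it is bi-additive, $A$-linear in the second variable, and $h(v,u)=\varepsilon h(u,v)^*$ for all $u,v$. Given $h$ on $V$, set $V(-1)=0$ and $V(i)=\{v\in V: h(V,v)\subset\mathfrak r^i\}$ for $i\ge0$; then $W(i)=V(i)/(\mathfrak rV(i-1)+V(i+1))$ is an $A/\mathfrak r$-vector space, and $d_i=\dim_{A/\mathfrak r}W(i)$ for $i\ge 0$. The numbers $d'_i$ are defined in the same way from $h'$ on $V'$. The forms $h$ and $h'$ are equivalent if there is an $A$-module isomorphism $\varphi:V\to V'$ with $h(u,v)=h'(\varphi(u),\varphi(v))$ for all $u,v\in V$. *)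

(* Defs.v *)
From HB Require Import structures.
From mathcomp Require Import all_boot all_order all_algebra.
From mathcomp Require Import boolp classical_sets functions.

Set Implicit Arguments.
Unset Strict Implicit.
Unset Printing Implicit Defensive.

Import GRing.Theory.
Local Open Scope ring_scope.
Local Open Scope classical_set_scope.
Local Open Scope quotient_scope.

Section Submodules.
Variables (A : comNzRingType) (M : lmodType A).

Definition submodule (P : set M) : Prop := submod_closed (mem P).

(* I P : the finite sums of products a *: v with a in I and v in P *)
Definition ideal_smul (I : set A) (P : set M) : set M :=
  [set v | exists2 s : seq (A * M),
     (forall p, p \in s -> I p.1 /\ P p.2) & v = \sum_(p <- s) p.1 *: p.2].

Definition submod_add (P Q : set M) : set M :=
  [set v | exists2 x, P x & exists2 y, Q y & v = x + y].

Lemma submoduleP (P : set M) :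
  submodule P <-> P 0 /\ (forall a u v, P u -> P v -> P (a *: u + v)).
Proof.
split=> [[P0 Plin]|[P0 Plin]].
  split=> [|a u v Pu Pv]; first by move: P0; rewrite in_setE.
  by have := Plin a u v (mem_set Pu) (mem_set Pv); rewrite in_setE.
split=> [|a u v Pu Pv]; first by rewrite -[_ \in _]/(0 \in P) in_setE.
move: Pu Pv; rewrite -![_ \in mem P]/(_ \in P) !in_setE; exact: Plin.
Qed.

Lemma submodule_smul I P : submodule P -> submodule (ideal_smul I P).
Proof.
move=> /submoduleP[_ Plin]; apply/submoduleP; split.
  by exists [::] => //; rewrite big_nil.
have [P0|nP0] := pselect (P 0); last first.
  move=> a u v [[|p s] Hs ->] Hv.
    by rewrite big_nil scaler0 add0r.
  have [_ Pp] := Hs p (mem_head _ _).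
  by case: nP0; rewrite -(addNr p.2) -scaleN1r; apply: Plin.
move=> a u v [s Hs ->] [t Ht ->].
exists ([seq (p.1, a *: p.2) | p <- s] ++ t) => [p|].
  rewrite mem_cat => /orP[/mapP[q qs ->]|/Ht//] /=.
  have [Iq Pq] := Hs _ qs; split=> //.
  by rewrite -[_ *: _]addr0; apply: Plin.
rewrite big_cat big_map scaler_sumr /=; congr (_ + _).
by apply: eq_bigr => p _; rewrite !scalerA mulrC.
Qed.

Lemma submodule_add P Q :
  submodule P -> submodule Q -> submodule (submod_add P Q).
Proof.
move=> /submoduleP[P0 Plin] /submoduleP[Q0 Qlin]; apply/submoduleP; split.
  by exists 0 => //; exists 0; rewrite ?addr0.
move=> a _ _ [x Px [y Qy ->]] [x' Px' [y' Qy' ->]].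
exists (a *: x + x'); first exact: Plin.
exists (a *: y + y'); first exact: Qlin.
by rewrite scalerDr addrACA.
Qed.

Lemma submodule_sum P (s : seq (A * M)) : submodule P ->
  (forall p, p \in s -> P (p.1 *: p.2)) -> P (\sum_(p <- s) p.1 *: p.2).
Proof.
move=> /submoduleP[P0 Plin] Hs; rewrite big_seq.
elim/big_ind: _ => // x y Px Py.
by rewrite -[x]scale1r; apply: Plin.
Qed.

Lemma submodule_scale P a v : submodule P -> P v -> P (a *: v).
Proof. by move=> /submoduleP[P0 Plin] Pv; rewrite -[_ *: _]addr0; apply: Plin. Qed.

End Submodules.

Section Ideals.
Variable A : comNzRingType.

Definition ideal (I : set A) : Prop := submodule (I : set A^o).

Definition maximal_ideal (I : set A) : Prop :=
  [/\ ideal I, I <> setT &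
      forall J, ideal J -> I `<=` J -> J = I \/ J = setT].

Definition ideal_pow (I : set A) (n : nat) : set A :=
  iter n (fun J : set A => ideal_smul I (J : set A^o)) setT.

Lemma ideal_ideal_pow (I : set A) n : ideal (ideal_pow I n).
Proof.
elim: n => [|n IHn]; first by apply/submoduleP.
exact: submodule_smul.
Qed.

Lemma ideal_powS (I : set A) n : ideal_pow I n.+1 `<=` ideal_pow I n.
Proof.
move=> _ [s Hs ->]; apply: (submodule_sum (M := A^o)).
  exact: ideal_ideal_pow.
move=> p /Hs[_ Hp].
exact: (submodule_scale (M := A^o) _ (ideal_ideal_pow _ _)).
Qed.

(* separation, and convergence of the Cauchy sequences of the I-adic metric *)
Definition adic_complete (I : set A) : Prop :=
  \bigcap_(i in [set i | 1 <= i]%N) ideal_pow I i = [set 0] /\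
  forall u : nat -> A,
    (forall i, exists N, forall m n, (N <= m)%N -> (N <= n)%N ->
       ideal_pow I i (u m - u n)) ->
    exists l, forall i, exists N, forall n, (N <= n)%N ->
       ideal_pow I i (u n - l).

End Ideals.

(* A discrete valuation ring is a local principal ideal domain that is not a   *)
(* field. The field maxideal adds no structure: the axioms determine it.        *)
HB.mixin Record IntegralDomain_isDVR A of GRing.IntegralDomain A := {
  maxideal : set A;
  maxidealP : maximal_ideal maxideal;
  maxideal_unique : forall I : set A, maximal_ideal I -> I = maxideal;
  maxideal_neq0 : maxideal <> [set 0];
  ideal_principal : forall I : set A, ideal I ->
    exists a, I = [set a * x | x in setT]
}.

#[short(type="dvrType")]
HB.structure Definition DVR :=
  {A of IntegralDomain_isDVR A & GRing.IntegralDomain A}.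

Arguments maxideal : clear implicits.

Section ResidueField.
Variable A : dvrType.
Notation r := (maxideal A).

Lemma maxideal0 : r 0.
Proof. by have [/submoduleP[]] := maxidealP (s := A). Qed.

Lemma maxideal_lin a u v : r u -> r v -> r (a * u + v).
Proof. by have [/submoduleP[_ H] _ _] := maxidealP (s := A); apply: H. Qed.

Lemma maxideal1 : ~ r 1.
Proof.
move=> r1; have [_ /eqP/negP[]] := maxidealP (s := A).
apply/eqP/seteqP; split=> // x _.
by rewrite -[x]mulr1 -[_ * _]addr0; apply: maxideal_lin => //; apply: maxideal0.
Qed.

Definition in_maxideal : A -> bool := fun x => x \in r.

Lemma in_maxideal_idealr : idealr_closed in_maxideal.
Proof.
split; rewrite ?unfold_in /in_maxideal; first exact/mem_set/maxideal0.
  by apply/negP; rewrite in_setE; apply: maxideal1.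
move=> a u v; rewrite !unfold_in /in_maxideal !in_setE.
exact: maxideal_lin.
Qed.

HB.instance Definition _ := isIdealr.Build A in_maxideal in_maxideal_idealr.

Definition residue := {ideal_quot (in_maxideal : idealr A)}.

HB.instance Definition _ := GRing.ComNzRing.on residue.
HB.instance Definition _ := Quotient.on residue.

Definition to_residue (a : A) : residue := \pi_residue a.

Lemma to_residueE a b : (to_residue a = to_residue b) <-> r (a - b).
Proof.
have <- : (a - b \in r) = r (a - b) :> Prop by rewrite in_setE.
have -> : (a - b \in r) = (to_residue a == to_residue b).
  exact: (Quotient.idealrBE (in_maxideal : idealr A)).
by split=> [/eqP|/eqP].
Qed.

Lemma to_residue_is_zmod : zmod_morphism to_residue.
Proof. by move=> x y; rewrite /to_residue; apply: rmorphB. Qed.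
Lemma to_residue_is_monoid : monoid_morphism to_residue.
Proof. by split; [apply: rmorph1 | move=> x y; apply: rmorphM]. Qed.

HB.instance Definition _ :=
  GRing.isZmodMorphism.Build A residue to_residue to_residue_is_zmod.
HB.instance Definition _ :=
  GRing.isMonoidMorphism.Build A residue to_residue to_residue_is_monoid.

Lemma to_residue_repr (x : residue) : to_residue (repr x) = x.
Proof. exact: reprK. Qed.

Lemma residue_inv_ex (x : residue) : exists y, x != 0 -> y * x = 1.
Proof.
have [->|x0] := eqVneq x 0; first by exists 0.
have nrx : ~ r (repr x).
  move=> rx; case/eqP: x0; rewrite -[x]to_residue_repr.
  by rewrite -(rmorph0 to_residue); apply/to_residueE; rewrite subr0.
pose J : set A := [set z | exists2 u, r u & exists b, z = u + b * repr x].
have JI : ideal J.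
  apply/submoduleP; split.
    by exists 0; [exact: maxideal0 | exists 0; rewrite mul0r addr0].
  move=> a _ _ [u ru [b ->]] [v rv [c ->]].
  exists (a * u + v); first exact: maxideal_lin.
  exists (a * b + c).
  by rewrite /GRing.scale /= mulrDr mulrDl mulrA addrACA.
have rJ : r `<=` J by move=> u ru; exists u => //; exists 0; rewrite mul0r addr0.
have [_ _ /(_ J JI rJ)] := maxidealP (s := A).
case=> [Jr|JT].
  case: nrx; rewrite -Jr; exists 0; first exact: maxideal0.
  by exists 1; rewrite mul1r add0r.
have [u ru [b e1]] : J 1 by rewrite JT.
exists (to_residue b) => _.
rewrite -[x in _ * x]to_residue_repr -rmorphM -(rmorph1 to_residue).
apply/to_residueE.
by rewrite e1 opprD addrCA subrr addr0 -sub0r -[- u]mulN1r addrC;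
   apply: maxideal_lin => //; apply: maxideal0.
Qed.

Definition residue_inv (x : residue) : residue :=
  if x == 0 then 0 else xget 0 [set y | y * x = 1].

Lemma residue_mulVf x : x != 0 -> residue_inv x * x = 1.
Proof.
move=> x0; rewrite /residue_inv (negPf x0).
have [y /(_ x0) yx] := residue_inv_ex x.
exact: (@xgetPex _ 0 [set z : residue | z * x = 1] (ex_intro _ y yx)).
Qed.

Lemma residue_inv0 : residue_inv 0 = 0.
Proof. by rewrite /residue_inv eqxx. Qed.

HB.instance Definition _ :=
  GRing.ComNzRing_isField.Build residue residue_mulVf residue_inv0.

Definition residue_involution (star : A -> A) (x : residue) : residue :=
  to_residue (star (repr x)).

Lemma maxideal_star (star : {rmorphism A -> A}) a :
  involutive star -> r a -> r (star a).
Proof.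
move=> starK; have [rI rT rmax] := maxidealP (s := A).
have starI (J : set A) : ideal J -> ideal (star @^-1` J).
  move=> /submoduleP[J0 Jlin]; apply/submoduleP; split.
    by rewrite /= rmorph0.
  by move=> c u v Ju Jv; rewrite /= rmorphD rmorphM; apply: Jlin.
suff {1}<- : star @^-1` r = r by [].
have starS (J : set A) : star @^-1` (star @^-1` J) = J.
  by apply/seteqP; split=> x /=; rewrite starK.
apply: maxideal_unique; split.
- exact: starI.
- by move=> e; apply: rT; rewrite -[r]starS e.
- move=> J JI rJ.
  have rJ' : r `<=` star @^-1` J.
    by move=> x rx; apply: rJ; rewrite /= starK.
  have [e|e] := rmax _ (starI J JI) rJ'.
  + by left; rewrite -e starS.
  + by right; rewrite -[J]starS e.
Qed.

Lemma residue_involutionE (star : {rmorphism A -> A}) a :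
  involutive star ->
  residue_involution star (to_residue a) = to_residue (star a).
Proof.
move=> starK; apply/to_residueE; rewrite -rmorphB; apply: maxideal_star => //.
by apply/to_residueE; rewrite to_residue_repr.
Qed.

Definition residue_fixed (star : A -> A) : set residue :=
  [set b | residue_involution star b = b].

Definition residue_norm (star : A -> A) (x : residue) : residue :=
  x * residue_involution star x.

End ResidueField.

(* M is free of rank n: there is a linear bijection from M onto R^n *)
Definition has_rank (R : nzRingType) (M : lmodType R) (n : nat) : Prop :=
  inhabited (Vector.axiom n M).

(* 0 if W is infinite dimensional, which does not happen for the spaces W(i)
   attached below to a free module of finite rank *)
Definition dimension (k : fieldType) (W : lmodType k) : nat :=
  xget 0%N [set n | has_rank W n].

(* P / Q as a vector space over the residue field, for submodules Q of P with *)
(* r P included in Q                                                          *)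
Section Subquotient.
Variables (A : dvrType) (M : lmodType A).
Notation r := (maxideal A).

Record subquot_data := SubquotData {
  sq_num : set M;
  sq_den : set M;
  sq_num_submod : submodule sq_num;
  sq_den_submod : submodule sq_den;
  sq_den_sub : sq_den `<=` sq_num;
  sq_ann : ideal_smul r sq_num `<=` sq_den
}.

Variable D : subquot_data.

Definition in_num : M -> bool := fun x => x \in sq_num D.

HB.instance Definition _ :=
  GRing.isSubmodClosed.Build A M in_num
    (GRing.submod_closed_semi (sq_num_submod D)).

Definition num_type := {x : M | in_num x}.

HB.instance Definition _ := SubChoice.on num_type.
HB.instance Definition _ := [SubChoice_isSubLmodule of num_type by <:].

Definition in_den : num_type -> bool := fun x => val x \in sq_den D.

Lemma in_den_zmod_closed : zmod_closed in_den.
Proof.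
have /submoduleP[Q0 Qlin] := sq_den_submod D.
split=> [|x y]; rewrite !unfold_in /in_den.
  by rewrite raddf0; apply: mem_set.
rewrite !in_setE => Qx Qy.
by rewrite raddfB -scaleN1r addrC; apply: Qlin.
Qed.

HB.instance Definition _ :=
  GRing.isZmodClosed.Build num_type in_den in_den_zmod_closed.

Definition subquot := Quotient.quot (GRing.ZmodClosed.clone num_type in_den _).

HB.instance Definition _ := GRing.Zmodule.on subquot.
HB.instance Definition _ := Quotient.on subquot.

Definition to_subquot (x : num_type) : subquot := \pi_subquot x.

Lemma to_subquotE x y : (to_subquot x = to_subquot y) <-> sq_den D (val x - val y).
Proof.
rewrite -raddfB.
have <- : (val (x - y) \in sq_den D) = sq_den D (val (x - y)) :> Prop.
  by rewrite in_setE.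
have -> : (val (x - y) \in sq_den D) = (to_subquot x == to_subquot y).
  exact: (@Quotient.idealrBE _ (GRing.ZmodClosed.clone num_type in_den _)).
by split=> [/eqP|/eqP].
Qed.

Lemma to_subquot_repr (x : subquot) : to_subquot (repr x) = x.
Proof. exact: reprK. Qed.

Lemma to_subquotD : {morph to_subquot : x y / x + y}.
Proof. by move=> x y; rewrite /to_subquot; apply: raddfD. Qed.

Definition subquot_scale (a : residue A) (x : subquot) : subquot :=
  to_subquot (repr a *: repr x).

Lemma subquot_scaleE (a : A) (x : num_type) :
  subquot_scale (to_residue a) (to_subquot x) = to_subquot (a *: x).
Proof.
have /submoduleP[Q0 Qlin] := sq_den_submod D.
set b := repr (to_residue a); set y := repr (to_subquot x).
have rba : maxideal A (b - a) by apply/to_residueE; rewrite to_residue_repr.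
have Qyx : sq_den D (val y - val x) by apply/to_subquotE; rewrite to_subquot_repr.
apply/to_subquotE; rewrite -/b -/y.
change (sq_den D (b *: val y - a *: val x)).
have -> : b *: val y - a *: val x = a *: (val y - val x) + (b - a) *: val y.
  by rewrite scalerBr scalerBl [RHS]addrC addrA subrK.
apply: Qlin => //; apply: sq_ann.
exists [:: (b - a, val y)]; last by rewrite big_seq1.
move=> p; rewrite inE => /eqP -> /=; split=> //.
by have := valP y; rewrite /in_num in_setE.
Qed.

Lemma subquot_scaleA a b v :
  subquot_scale a (subquot_scale b v) = subquot_scale (a * b) v.
Proof.
rewrite -[a]to_residue_repr -[b]to_residue_repr -[v]to_subquot_repr.
by rewrite -rmorphM !subquot_scaleE scalerA.
Qed.

Lemma subquot_scale1 : left_id 1 subquot_scale.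
Proof.
move=> v; rewrite -[v]to_subquot_repr -(rmorph1 (@to_residue A)).
by rewrite subquot_scaleE scale1r.
Qed.

Lemma subquot_scaleDr : right_distributive subquot_scale +%R.
Proof.
move=> a u v; rewrite -[a]to_residue_repr.
rewrite -[u]to_subquot_repr -[v]to_subquot_repr.
by rewrite -to_subquotD !subquot_scaleE scalerDr to_subquotD.
Qed.

Lemma subquot_scaleDl v : {morph subquot_scale^~ v : a b / a + b}.
Proof.
move=> a b; rewrite -[a]to_residue_repr -[b]to_residue_repr.
rewrite -[v]to_subquot_repr.
by rewrite -rmorphD !subquot_scaleE scalerDl to_subquotD.
Qed.

HB.instance Definition _ := GRing.Zmodule_isLmodule.Build (residue A) subquot
  subquot_scaleA subquot_scale1 subquot_scaleDr subquot_scaleDl.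

End Subquotient.

(* Unlike the forms of sesquilinear.v, these are linear in the second variable. *)
Record hermitian_form (A : comNzRingType) (star : A -> A) (eps : A)
    (V : lmodType A) := HermitianForm {
  hform :> V -> V -> A;
  hformDl : forall u v w, hform (u + v) w = hform u w + hform v w;
  hformDr : forall u v w, hform u (v + w) = hform u v + hform u w;
  hformZr : forall a u v, hform u (a *: v) = a * hform u v;
  hform_sym : forall u v, hform v u = eps * star (hform u v)
}.

Section Invariants.
Variables (A : dvrType) (star : A -> A) (eps : A) (V : lmodType A).
Variable h : hermitian_form star eps V.
Notation r := (maxideal A).

Definition Vfil (i : nat) : set V :=
  [set v | forall u, ideal_pow r i (h u v)].

(* V(i - 1), with V(-1) = 0 *)
Definition Vfil_pred (i : nat) : set V :=
  if i is j.+1 then Vfil j else [set 0].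

(* r V(i - 1) + V(i + 1) *)
Definition Vden (i : nat) : set V :=
  submod_add (ideal_smul r (Vfil_pred i)) (Vfil i.+1).

Lemma Vfil_submod i : submodule (Vfil i).
Proof.
have /submoduleP[I0 Ilin] := ideal_ideal_pow r i.
have h0 u : h u 0 = 0 by rewrite -(scale0r 0) hformZr mul0r.
apply/submoduleP; split=> [u|a x y Vx Vy u]; first by rewrite h0.
by rewrite hformDr hformZr; apply: Ilin.
Qed.

Lemma Vfil_pred_submod i : submodule (Vfil_pred i).
Proof.
case: i => [|i]; last exact: Vfil_submod.
by apply/submoduleP; split=> // a _ _ -> ->; rewrite /= scaler0 addr0.
Qed.

Lemma Vden_submod i : submodule (Vden i).
Proof.
apply: submodule_add; last exact: Vfil_submod.
by apply: submodule_smul; apply: Vfil_pred_submod.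
Qed.

Lemma smul_Vfil i : ideal_smul r (Vfil i) `<=` Vfil i.+1.
Proof.
move=> _ [s Hs ->]; apply: submodule_sum; first exact: Vfil_submod.
move=> p /Hs[rp Vp] u; rewrite hformZr.
exists [:: (p.1, h u p.2)]; last by rewrite big_seq1.
by move=> q; rewrite inE => /eqP ->; split=> //; apply: Vp.
Qed.

Lemma Vfil_ann i : ideal_smul r (Vfil i) `<=` Vden i.
Proof.
move=> v /smul_Vfil Vv; exists 0; last by exists v; rewrite ?add0r.
by exists [::] => //; rewrite big_nil.
Qed.

Lemma Vden_sub i : Vden i `<=` Vfil i.
Proof.
move=> _ [x Hx [y Vy ->]].
have /submoduleP[V0 Vlin] := Vfil_submod i.
rewrite -[x]scale1r; apply: Vlin; last by move=> u; apply: ideal_powS.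
case: i Hx {Vy V0} => [|i] Hx; last exact: smul_Vfil.
by move=> u.
Qed.

Definition Wdata (i : nat) : subquot_data V :=
  SubquotData (Vfil_submod i) (Vden_submod i) (@Vden_sub i) (@Vfil_ann i).

(* W(i) = V(i) / (r V(i - 1) + V(i + 1)) *)
Definition W (i : nat) : lmodType (residue A) := subquot (Wdata i).

Definition dinv (i : nat) : nat := dimension (W i).

End Invariants.

Definition hform_equiv (A : comNzRingType) (star : A -> A) (eps : A)
    (V V' : lmodType A) (h : hermitian_form star eps V)
    (h' : hermitian_form star eps V') : Prop :=
  exists phi : {linear V -> V'},
    bijective phi /\ forall u v, h u v = h' (phi u) (phi v).

(* Main.v *)
Require Import Defs.
From HB Require Import structures.
From mathcomp Require Import all_boot all_order all_algebra.
From mathcomp Require Import boolp classical_sets functions.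
From mathcomp Require Import ring.
Set Implicit Arguments.
Unset Strict Implicit.
Unset Printing Implicit Defensive.
Import GRing.Theory.
Local Open Scope ring_scope.
Local Open Scope classical_set_scope.

(* Choose a uniformizer p with p^* = s p, s = 1 or -1. If p^n is the exact
   power dividing all values of h, then h = p^n k, where k takes a unit value and
   is hermitian for the sign eps s^n. If some unit c satisfies c = eps s^n c^*,
   then k represents c, because c/2 + eps s^n (c/2)^* = c and the norm is
   surjective onto fixed units; otherwise k represents a hyperbolic plane. Splitting
   off p^n c or p^n times the plane and inducting on the rank gives a standard
   form, whose type at level n depends on n only. In standard coordinates,
   d_i is the number of coordinates of level i, so the d_i and the rank determine
   the multiset of summands. Completeness enters through the fixed-point theorem
   for contractions of r, which inverts 1 + x and extracts its square root for
   x in r. *)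

(** * Units and square roots in a complete discrete valuation ring *)

Lemma inj_surj_bijective (T U : Type) (f : T -> U) :
  injective f -> (forall y, exists x, f x = y) -> bijective f.
Proof.
move=> finj /choice[g gK]; exists g => // x.
by apply: finj; rewrite gK.
Qed.

Section Valuation.
Variable A : dvrType.
Notation r := (maxideal A).

Lemma maxidealD x y : r x -> r y -> r (x + y).
Proof. by move=> rx ry; rewrite -[x]mul1r; apply: maxideal_lin. Qed.

Lemma maxidealM a x : r x -> r (a * x).
Proof. by move=> rx; rewrite -[_ * _]addr0; apply: maxideal_lin (maxideal0 _). Qed.

Lemma maxidealMr a x : r x -> r (x * a).
Proof. by rewrite mulrC; apply: maxidealM. Qed.

Lemma maxidealN x : r x -> r (- x).
Proof. by rewrite -mulN1r; apply: maxidealM. Qed.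

Lemma maxidealB x y : r x -> r y -> r (x - y).
Proof. by move=> rx ry; apply: maxidealD => //; apply: maxidealN. Qed.

Lemma unitr_not_maxideal x : x \is a GRing.unit -> ~ r x.
Proof.
by move=> ux rx; apply: (@maxideal1 A); rewrite -(mulVr ux); apply: maxidealM.
Qed.

Lemma to_residueM (a b : A) : to_residue (a * b) = to_residue a * to_residue b.
Proof. exact: rmorphM. Qed.

Lemma to_residueD (a b : A) : to_residue (a + b) = to_residue a + to_residue b.
Proof. exact: rmorphD. Qed.

Lemma to_residue_eq0 (a : A) : to_residue a = 0 <-> r a.
Proof.
have e0 : to_residue (0 : A) = 0 by exact: rmorph0.
by rewrite -e0; apply: (iff_trans (to_residueE _ _)); rewrite subr0.
Qed.

Lemma uniformizer_exists :
  exists2 p : A, p != 0 & forall x, r x <-> exists q, x = p * q.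
Proof.
have [rI _ _] := maxidealP (s := A).
have [p rp] := ideal_principal _ rI.
have rE x : r x <-> exists q, x = p * q.
  by rewrite rp; split=> [[q _ <-]|[q ->]]; exists q.
exists p => //; apply/eqP => p0; apply: (@maxideal_neq0 A).
apply/seteqP; split=> [x /rE[q ->]|_ ->]; first by rewrite p0 mul0r.
exact: maxideal0.
Qed.

Lemma ideal_powE p i x : (forall y, r y <-> exists q, y = p * q) ->
  ideal_pow r i x <-> exists q, x = p ^+ i * q.
Proof.
move=> rE; elim: i x => [|i IHi] x; first by split=> // _; exists x; rewrite mul1r.
split=> [[s Hs ->]|[q ->]]; last first.
  exists [:: (p, p ^+ i * q)]; last by rewrite big_seq1 exprS -mulrA.
  move=> z; rewrite inE => /eqP -> /=; split; last by apply/IHi; exists q.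
  by apply/rE; exists 1; rewrite mulr1.
rewrite big_seq; elim/big_ind: _ => [|_ _ [a ->] [b ->]|z /Hs[/rE[a ea] /IHi[b eb]]].
- by exists 0; rewrite mulr0.
- by exists (a + b); rewrite mulrDr.
- by exists (a * b); rewrite ea eb exprS /GRing.scale /=; ring.
Qed.

Hypothesis Acomplete : adic_complete r.

Lemma ideal_pow_separated x : (forall i, ideal_pow r i x) -> x = 0.
Proof.
move=> rx; have [sep _] := Acomplete.
suff : [set 0] x by [].
by rewrite -sep => i _.
Qed.

(** The iterates of 0 satisfy [u (n + m) - u n] in [r^n], so they converge by completeness. The
    limit [l] is fixed because [T l - l] lies in every [r^i]. *)
Lemma contraction_fixpoint (T : A -> A) :
    (forall a, r a -> r (T a)) ->
    (forall a b, r a -> r b -> exists2 t, r t & T a - T b = t * (a - b)) ->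
  exists2 a, r a & T a = a.
Proof.
move=> Tr Tcontr; have [p p0 rE] := uniformizer_exists.
have powE i x := ideal_powE i x rE.
pose u n := iter n T 0.
have ru n : r (u n) by elim: n => [|n IHn]; [exact: maxideal0 | exact: Tr].
have du n m : exists q, u (n + m)%N - u n = p ^+ n * q.
  elim: n => [|n [q eq]]; first by eexists; rewrite mul1r.
  have [t /rE[t' ->] e] := Tcontr _ _ (ru (n + m)%N) (ru n).
  by exists (t' * q); rewrite [LHS]e eq exprS; ring.
have cauchy i : exists N, forall m n, (N <= m)%N -> (N <= n)%N ->
    ideal_pow r i (u m - u n).
  exists i => m n im in'; apply/powE.
  have [q1 e1] := du i (m - i)%N; have [q2 e2] := du i (n - i)%N.
  exists (q1 - q2); rewrite mulrBr -e1 -e2 !subnKC //; ring.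
have [l lim] := Acomplete.2 u cauchy.
have rl : r l.
  have [N /(_ _ (leqnn N))/powE[q e]] := lim 1%N.
  have -> : l = u N - (u N - l) by ring.
  by apply: maxidealB => //; apply/rE; exists q.
exists l => //; apply/eqP; rewrite -subr_eq0; apply/eqP.
apply: ideal_pow_separated => i; apply/powE.
have [N limN] := lim i.
have [q1 e1] : exists q, u N - l = p ^+ i * q by apply/powE; apply: limN.
have [q2 e2] : exists q, u N.+1 - l = p ^+ i * q by apply/powE; apply: limN.
have [t _ e] := Tcontr _ _ rl (ru N).
exists (q2 - t * q1).
have -> : T l - l = (T l - T (u N)) + (u N.+1 - l) by rewrite /u /=; ring.
by rewrite e e2 -opprB e1; ring.
Qed.

(** Writing the inverse as [1 + a] turns the equation into [a = - z - z * a], whose right side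
    contracts [r]. *)
Lemma unitr_1D z : r z -> 1 + z \is a GRing.unit.
Proof.
move=> rz.
have [|a b _ _|a ra e] := contraction_fixpoint (T := fun a => - z - z * a).
- by move=> a ra; apply: maxidealB; [apply: maxidealN | apply: maxidealMr].
- by exists (- z); [exact: maxidealN | ring].
- have {}e : (1 + z) * (1 + a) = 1.
    suff : z + a + z * a = 0 by move=> s; rewrite -[RHS]addr0 -s; ring.
    by rewrite -{1}e; ring.
  by apply/unitrP; exists (1 + a); split; rewrite // mulrC.
Qed.

(** An inverse in the residue field lifts to some [y] with [x * y] in [1 + r], which consists of
    units. *)
Lemma unitrE_maxideal x : ~ r x -> x \is a GRing.unit.
Proof.
move=> nrx.
have x0 : to_residue x != 0.
  by apply/eqP => /to_residue_eq0.
pose y := repr ((to_residue x)^-1).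
have : to_residue (x * y) = to_residue 1.
  have yE : to_residue y = (to_residue x)^-1 by exact: to_residue_repr.
  by rewrite to_residueM yE divff //; apply/esym; exact: rmorph1.
move=> e; have /unitr_1D := (to_residueE _ _).1 e.
by rewrite addrC subrK unitrM => /andP[].
Qed.

Lemma unitr_add_maxideal x z : x \is a GRing.unit -> r z -> x + z \is a GRing.unit.
Proof.
move=> ux rz; apply: unitrE_maxideal => rxz.
by apply: (unitr_not_maxideal ux); rewrite -(addrK z x); apply: maxidealB.
Qed.

Lemma maxideal_or_unit x : r x \/ x \is a GRing.unit.
Proof. by have [|/unitrE_maxideal] := pselect (r x); [left|right]. Qed.

(** Separation gives a least [i] with [x] outside [r^i]. It is positive since [r^0] is the whole
    ring, and the exponent sought is [i - 1]. *)
Lemma unit_part p (x : A) : (forall y, r y <-> exists q, y = p * q) -> x != 0 ->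
  exists n, exists2 c, c \is a GRing.unit & x = p ^+ n * c.
Proof.
move=> rE x0; have powE i y := ideal_powE i y rE.
have [i nrx] : exists i, ~ ideal_pow r i x.
  by apply/existsNP => /ideal_pow_separated/eqP; rewrite (negPf x0).
have exi : exists i, `[< ~ ideal_pow r i x >] by exists i; apply/asboolP.
case: (ex_minnP exi) => -[|n] /asboolP nr min; first by case: nr.
have [c xc] : exists c, x = p ^+ n * c.
  by apply/powE; apply: contrapT => /asboolP/min; rewrite ltnn.
exists n, c => //; apply: unitrE_maxideal => /rE[q cq]; apply: nr.
by apply/powE; exists q; rewrite xc cq exprSr mulrA.
Qed.

(** The equation reads [a = (x - a^2) / 2], and its right side contracts [r] because
    [a^2 - b^2 = (a + b) (a - b)]. *)
Lemma sqrt_1D x : 2%:R \is a @GRing.unit A -> r x ->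
  exists2 a, r a & (1 + a) ^+ 2 = 1 + x.
Proof.
move=> u2 rx; pose k : A := 2%:R^-1.
have k2 : 2%:R * k = 1 by rewrite mulrV.
have [|a b ra rb|a ra e] := contraction_fixpoint (T := fun a => k * (x - a * a)).
- by move=> a ra; apply/maxidealM/maxidealB => //; apply: maxidealM.
- by exists (- (k * (a + b))); [apply/maxidealN/maxidealM/maxidealD | ring].
- exists a => //; have e2 : 2%:R * a = x - a * a.
    by rewrite -[in LHS]e mulrA k2 mul1r.
  by rewrite -[x](subrK (a * a)) -e2; ring.
Qed.

End Valuation.

(** * Hermitian spaces and orthogonal sums *)

Lemma exists_linear (R : nzRingType) (V W : lmodType R) (f : V -> W) :
  linear f -> exists F : {linear V -> W}, F =1 f.
Proof.
move=> flin; pose f' := GRing.isLinear.Build R V W *:%R f flin.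
by exists (HB.pack f f' : {linear V -> W}).
Qed.

Section FormLemmas.
Variables (A : comNzRingType) (star : {rmorphism A -> A}) (eps : A).
Variables (V : lmodType A) (h : hermitian_form star eps V).
Hypothesis starK : involutive star.

Lemma hform0r u : h u 0 = 0.
Proof. by rewrite -(scale0r 0) hformZr mul0r. Qed.

Lemma hform0l u : h 0 u = 0.
Proof. by rewrite (hform_sym h u) hform0r rmorph0 mulr0. Qed.

Lemma hformZl a u v : h (a *: u) v = star a * h u v.
Proof. by rewrite (hform_sym h v) hformZr rmorphM mulrCA -hform_sym. Qed.

End FormLemmas.

Section HermitianSpaces.
Variables (A : comNzRingType) (star : {rmorphism A -> A}) (eps : A).
Hypothesis starK : involutive star.
Hypothesis epsK : eps * star eps = 1.

(** Bundling the module with its form lets orthogonal sums be folded over a list. *)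
Record hspace := Hspace {
  hcar : lmodType A;
  hfrm : hermitian_form star eps hcar
}.

Definition hiso (X Y : hspace) : Prop := hform_equiv (hfrm X) (hfrm Y).

Lemma hform_equivI (V V' : lmodType A) (h : hermitian_form star eps V)
    (h' : hermitian_form star eps V') (f : V -> V') :
  linear f -> bijective f -> (forall u v, h u v = h' (f u) (f v)) ->
  hform_equiv h h'.
Proof.
move=> flin fbij fiso.
have [F FE] := exists_linear flin; exists F; split=> [|u v].
  exact: eq_bij fbij _ (fsym FE).
by rewrite !FE.
Qed.

Lemma hiso_refl X : hiso X X.
Proof. by apply: (@hform_equivI _ _ _ _ id) => //; exists id. Qed.

Lemma hiso_sym X Y : hiso X Y -> hiso Y X.
Proof.
move=> [f [[g fK gK] fiso]]; apply: (@hform_equivI _ _ _ _ g).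
- by move=> a u v; apply: (can_inj fK); rewrite linearP !gK.
- by exists f.
- by move=> u v; rewrite fiso !gK.
Qed.

Lemma hiso_trans Y X Z : hiso X Y -> hiso Y Z -> hiso X Z.
Proof.
move=> [f [fbij fiso]] [g [gbij giso]]; apply: (@hform_equivI _ _ _ _ (g \o f)).
- by move=> a u v; rewrite /= !linearP.
- exact: bij_comp.
- by move=> u v; rewrite fiso giso.
Qed.

Definition line_form (d : A) (hd : eps * star d = d) :
  hermitian_form star eps A^o.
Proof.
apply: (@HermitianForm A star eps A^o (fun x y => star x * d * y)).
- by move=> u v w; rewrite rmorphD !mulrDl.
- by move=> u v w; rewrite mulrDr.
- by move=> a u v; rewrite /GRing.scale /= mulrCA.
- by move=> u v; rewrite !rmorphM starK -[in LHS]hd; ring.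
Defined.

(** The plane with an isotropic basis whose first vector pairs with the second to [d]; hermitian
    symmetry forces the second term. *)
Definition hyperbolic_form (d : A) : hermitian_form star eps (A^o * A^o)%type.
Proof.
apply: (@HermitianForm A star eps (A^o * A^o)%type
  (fun x y => d * star x.1 * y.2 + eps * star d * star x.2 * y.1)).
- by move=> u v w; rewrite !rmorphD; ring.
- by move=> u v w /=; ring.
- by move=> a u v; rewrite /= /GRing.scale /=; ring.
- by move=> u v; rewrite !(rmorphD, rmorphM) !starK /=; ring: epsK.
Defined.

Definition zero_form (V : lmodType A) : hermitian_form star eps V.
Proof.
apply: (@HermitianForm A star eps V (fun _ _ => 0)) => *;
  by rewrite ?rmorph0 ?mulr0 ?addr0.
Defined.

Definition sum_form (V W : lmodType A) (h : hermitian_form star eps V)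
  (k : hermitian_form star eps W) : hermitian_form star eps (V * W)%type.
Proof.
apply: (@HermitianForm A star eps (V * W)%type
  (fun x y => h x.1 y.1 + k x.2 y.2)).
- by move=> u v w; rewrite /= !hformDl addrACA.
- by move=> u v w; rewrite /= !hformDr addrACA.
- by move=> a u v; rewrite /= !hformZr mulrDr.
- by move=> u v; rewrite /= rmorphD mulrDr -!hform_sym.
Defined.

Definition pullback_form (V W : lmodType A) (h : hermitian_form star eps V)
  (g : {linear W -> V}) : hermitian_form star eps W.
Proof.
apply: (@HermitianForm A star eps W (fun x y => h (g x) (g y))).
- by move=> u v w; rewrite linearD hformDl.
- by move=> u v w; rewrite linearD hformDr.
- by move=> a u v; rewrite linearZ hformZr.
- by move=> u v; rewrite -hform_sym.
Defined.

Definition hsum (X Y : hspace) : hspace := Hspace (sum_form (hfrm X) (hfrm Y)).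

Lemma hsum_hiso X Y Z : hiso Y Z -> hiso (hsum X Y) (hsum X Z).
Proof.
move=> [f [[g fK gK] fiso]].
apply: (@hform_equivI _ _ _ _
  (fun x : hcar X * hcar Y => (x.1, f x.2) : hcar X * hcar Z)).
- by move=> a u v; rewrite /= linearP.
- by exists (fun x => (x.1, g x.2)) => -[x y] /=; rewrite ?fK ?gK.
- by move=> u v; rewrite /= fiso.
Qed.

Lemma hsum_swap X Y Z : hiso (hsum X (hsum Y Z)) (hsum Y (hsum X Z)).
Proof.
apply: (@hform_equivI _ _ _ _
  (fun x : hcar X * (hcar Y * hcar Z) =>
     (x.2.1, (x.1, x.2.2)) : hcar Y * (hcar X * hcar Z))).
- by [].
- by exists (fun x => (x.2.1, (x.1, x.2.2))) => -[x [y z]].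
- by move=> u v /=; rewrite addrCA.
Qed.

(** Swaps of neighbouring summands bring any member of the list to the front; induction then removes
    it from both lists. *)
Lemma hsum_seq_perm (T : eqType) (F : T -> hspace) (X : hspace) (s t : seq T) :
  perm_eq s t ->
  hiso (foldr (fun a => hsum (F a)) X s) (foldr (fun a => hsum (F a)) X t).
Proof.
set c := foldr _ X.
have crem a u : a \in u -> hiso (c u) (c (a :: rem a u)).
  elim: u => [//|b u IHu]; rewrite inE /= eq_sym.
  case: (eqVneq a b) => [-> _|ab /= /IHu IH]; first exact: hiso_refl.
  by apply: (hiso_trans (Y := hsum (F b) (c (a :: rem a u))));
     [exact: hsum_hiso | exact: hsum_swap].
elim: s t => [|a s IHs] t st.
  by move: st; rewrite perm_sym => /perm_nilP ->; apply: hiso_refl.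
have at' : a \in t by rewrite -(perm_mem st) mem_head.
apply: (hiso_trans (Y := c (a :: rem a t))); last exact/hiso_sym/crem.
apply/hsum_hiso/IHs; rewrite -(perm_cons a).
exact: perm_trans st (perm_to_rem at').
Qed.

End HermitianSpaces.

(** * Splitting off lines and hyperbolic planes *)

Section Splitting.
Variable A : dvrType.
Notation r := (maxideal A).
Hypothesis Acomplete : adic_complete r.

Lemma functionalZ (V : lmodType A) (f : {linear V -> A^o}) a x :
  f (a *: x) = a * f x.
Proof. by rewrite linearZ. Qed.

(** Since [f v = 1], some coordinate of [v] is a unit. The vectors vanishing at that coordinate,
    corrected by multiples of [v], parametrize the kernel of [f]. *)
Lemma split_functional m (v : 'rV[A]_m) (f : {linear 'rV[A]_m -> A^o}) :
  f v = 1 ->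
  exists m', m = m'.+1 /\ exists g : {linear 'rV[A]_m' -> 'rV[A]_m},
    (forall w, f (g w) = 0) /\
    bijective (fun x : A^o * 'rV[A]_m' => x.1 *: v + g x.2).
Proof.
case: m v f => [|m] v f fv.
  by have := oner_neq0 A; rewrite -fv [v]thinmx0 linear0 eqxx.
exists m; split=> //.
(* Otherwise all coordinates of [v] lie in [r], and then so does [f v = 1]. *)
have [i ui] : exists i, v 0 i \is a GRing.unit.
  apply: contrapT => /forallNP nu.
  apply: (@maxideal1 A); rewrite -fv [v]row_sum_delta linear_sum.
  elim/big_ind: _ => [||i _]; [exact: maxideal0 | exact: maxidealD | ].
  rewrite functionalZ; apply: maxidealMr.
  by have [//|/(nu i)] := maxideal_or_unit Acomplete (v 0 i).
pose emb (w : 'rV[A]_m) : 'rV[A]_m.+1 :=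
  \row_j if unlift i j is Some k then w 0 k else 0.
have emb_lift w k : emb w 0 (lift i k) = w 0 k by rewrite mxE liftK.
have emb_i w : emb w 0 i = 0 by rewrite mxE unlift_none.
have embE (x : 'rV[A]_m.+1) : x 0 i = 0 -> emb (col' i x) = x.
  move=> x0; apply/rowP => j; have [k ->|->] := unliftP i j.
    by rewrite emb_lift mxE.
  by rewrite emb_i x0.
have emb_linear : linear emb.
  move=> a x y; apply/rowP => j; have [k ->|->] := unliftP i j.
    by rewrite !(mxE, liftK).
  by rewrite !(mxE, unlift_none) mulr0 addr0.
(* [g] inserts a zero coordinate, then projects onto the kernel of [f] along [v]. *)
have [g gE] : exists g : {linear 'rV[A]_m -> 'rV[A]_m.+1},
    g =1 fun w => emb w - f (emb w) *: v.
  apply: exists_linear => a x y; rewrite emb_linear linearP.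
  by rewrite scalerBr scalerDl opprD addrACA scalerA.
have fg w : f (g w) = 0.
  by rewrite gE linearB functionalZ fv mulr1 subrr.
exists g; split=> //; apply: inj_surj_bijective => [[a x] [b y] /= e|x].
  have eab : a = b.
    have := congr1 f e; by rewrite !linearD !functionalZ !fg fv !addr0 !mulr1.
  congr pair => //; move: e; rewrite eab => /addrI; rewrite !gE => e.
  (* Compare the coordinates at [i], where [emb] vanishes and [v] has a unit. *)
  have ef : f (emb x) = f (emb y).
    have := congr1 (fun z : 'rV_m.+1 => z 0 i) e.
    rewrite !(mxE, unlift_none) !add0r => /oppr_inj.
    exact: mulIr.
  move: e; rewrite ef => /addIr e; apply/rowP => k.
  by rewrite -!emb_lift e.
(* [y] is the kernel component of [x], and [c] is chosen so that [y - c *: v] lies in the image of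
   [emb]. Then [g] gives back [y], because [f (y - c *: v) = - c]. *)
pose y := x - f x *: v; pose c := y 0 i / v 0 i.
have fy : f y = 0 by rewrite linearB functionalZ fv mulr1 subrr.
have z0 : (y - c *: v) 0 i = 0 
  by rewrite mxE [X in _ + X]mxE [X in - X]mxE /c divrK // subrr.
exists (f x, col' i (y - c *: v)) => /=.
rewrite gE embE // linearB functionalZ fv fy mulr1 sub0r.
by rewrite scaleNr opprK subrK addrC subrK.
Qed.

Lemma split_linear (V W : lmodType A) v (g : {linear W -> V}) :
  linear (fun x : A^o * W => x.1 *: v + g x.2).
Proof.
move=> a [x x'] [y y'] /=; rewrite linearP scalerDl -[a *: x]/(a * x).
by rewrite -scalerA scalerDr addrACA.
Qed.

End Splitting.

Section SplitForms.
Variables (A : dvrType) (star : {rmorphism A -> A}) (eps : A).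
Notation r := (maxideal A).
Hypothesis Acomplete : adic_complete r.
Hypothesis starK : involutive star.
Hypothesis epsK : eps * star eps = 1.

(** Division by [d] is unique in a domain, so the quotients inherit linearity. *)
Lemma exists_quotient_functional (V : lmodType A)
    (h : hermitian_form star eps V) u d : d != 0 ->
    (forall x, exists q, h u x = d * q) ->
  exists f : {linear V -> A^o}, forall x, h u x = d * f x.
Proof.
move=> d0 /choice[f fE].
suff [F FE] : exists F : {linear V -> A^o}, F =1 f.
  by exists F => x; rewrite FE.
apply: exists_linear => a x y; apply: (mulfI d0).
by rewrite -fE hformDr hformZr !fE /GRing.scale /= mulrDr mulrCA.
Qed.

(** The kernel of [f] is orthogonal to [v], so splitting the module along [f] splits the form.
    Taking [f] as data, instead of dividing by [d], covers [d = 0], where [v] lies in the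
    radical. *)
Lemma split_line m (h : hermitian_form star eps 'rV[A]_m) v
    (f : {linear 'rV[A]_m -> A^o}) d (hd : eps * star d = d) :
    h v v = d -> (forall x, h v x = d * f x) -> f v = 1 ->
  exists m', m = m'.+1 /\ exists h' : hermitian_form star eps 'rV[A]_m',
    hiso (Hspace h) (hsum (Hspace (line_form starK hd)) (Hspace h')).
Proof.
move=> hvv hv fv; have [m' [em [g [fg gbij]]]] := split_functional Acomplete fv.
exists m'; split=> //; exists (pullback_form h g).
apply: hiso_sym.
apply: (@hform_equivI _ _ _ _ _ _ _
  (fun x : A^o * 'rV[A]_m' => x.1 *: v + g x.2)) => //.
  exact: split_linear.
move=> [a x] [b y] /=; rewrite !hformDl !hformDr !hformZl // !hformZr hvv.
rewrite hv fg (hform_sym h v (g x)) hv fg mulr0 rmorph0.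
by rewrite !mulr0 addr0 add0r [b * _]mulrC mulrA.
Qed.

(** The functionals [h v] divided by [eps * star d] and [h u] divided by [d] are dual to [u] and
    [v]. Splitting off [u] by the first and then [v] by the second leaves their common kernel, which
    is orthogonal to both vectors. *)
Lemma split_hyperbolic m (h : hermitian_form star eps 'rV[A]_m) u v d :
    d != 0 -> (forall x, exists q, h u x = d * q) ->
    (forall x, exists q, h v x = eps * star d * q) ->
    h u u = 0 -> h v v = 0 -> h u v = d ->
  exists m', m = m'.+2 /\ exists h' : hermitian_form star eps 'rV[A]_m',
    hiso (Hspace h) (hsum (Hspace (hyperbolic_form starK epsK d)) (Hspace h')).
Proof.
move=> d0 du dv huu hvv huv.
have hvu : h v u = eps * star d by rewrite (hform_sym h u) huv.
have eps0 : eps != 0.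
  by apply/eqP => e; have := oner_neq0 A; rewrite -epsK e mul0r eqxx.
have d'0 : eps * star d != 0.
  rewrite mulf_neq0 //; apply: contraNneq d0 => e.
  by rewrite -[d]starK e rmorph0.
have [f1 f1E] := exists_quotient_functional d'0 dv.
have [f2 f2E] := exists_quotient_functional d0 du.
have f1u : f1 u = 1 by apply: (mulfI d'0); rewrite -f1E mulr1.
have f1v : f1 v = 0 by apply: (mulfI d'0); rewrite -f1E mulr0.
have f2v : f2 v = 1 by apply: (mulfI d0); rewrite -f2E mulr1.
have f2u : f2 u = 0 by apply: (mulfI d0); rewrite -f2E mulr0.
have [m1 [em1 [g1 [f1g1 g1bij]]]] := split_functional Acomplete f1u.
(* As [f1 v = 0], the vector [v] lies in the complement of [u]; [w] is its preimage there. *)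
have [w gw] : exists w, g1 w = v.
  have [k _ kK] := g1bij; exists (k v).2.
  have := kK v; set t := k v => e.
  suff t1 : t.1 = 0 by rewrite -[RHS]e t1 scale0r add0r.
  by have := congr1 f1 e; rewrite linearD functionalZ f1u f1g1 f1v addr0 mulr1.
have [f3 f3E] : exists f3 : {linear 'rV[A]_m1 -> A^o}, f3 =1 f2 \o g1.
  by apply: exists_linear => a x y; rewrite /= !linearP.
have f3w : f3 w = 1 by rewrite f3E /= gw.
have [m2 [em2 [g2 [f3g2 g2bij]]]] := split_functional Acomplete f3w.
exists m2; split; first by rewrite em1 em2.
exists (pullback_form (pullback_form h g1) g2); apply: hiso_sym.
have hg x : h u (g1 (g2 x)) = 0 /\ h v (g1 (g2 x)) = 0.
  by rewrite f1E f2E f1g1 -[f2 _]f3E f3g2 !mulr0.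
have hg' x : h (g1 (g2 x)) u = 0 /\ h (g1 (g2 x)) v = 0.
  have [hu hv] := hg x.
  by rewrite (hform_sym h u) (hform_sym h v) hu hv rmorph0 mulr0.
apply: (@hform_equivI _ _ _ _ _ _ _
  (fun x : (A^o * A^o) * 'rV[A]_m2 =>
     x.1.1 *: u + g1 (x.1.2 *: w + g2 x.2))).
- move=> a [[x1 x2] x] [[y1 y2] y].
  have := split_linear w g2 a (x2, x) (y2, y) => /= ->.
  exact: (split_linear u g1 a (x1, _) (y1, _)).
- have [k1 k1K k1K'] := g1bij; have [k2 k2K k2K'] := g2bij.
  exists (fun z => (((k1 z).1, (k2 (k1 z).2).1), (k2 (k1 z).2).2)).
    move=> [[x1 x2] x] /=; have /= -> := k1K (x1, x2 *: w + g2 x) => /=.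
    by have /= -> := k2K (x2, x).
  by move=> z /=; rewrite k2K' k1K'.
- move=> [[x1 x2] x] [[y1 y2] y] /=.
  rewrite !linearD !linearZ /= gw !hformDl !hformDr !hformZl // !hformZr.
  have [-> ->] := hg y; have [-> ->] := hg' x.
  by rewrite huu hvv huv hvu; ring.
Qed.
End SplitForms.

(** * Norms, represented values and isotropic vectors of forms with a unit value *)

Section Unimodular.
Variables (A : dvrType) (star : {rmorphism A -> A}).
Notation r := (maxideal A).
Hypothesis Acomplete : adic_complete r.
Hypothesis unit2 : (2%:R : A) \is a GRing.unit.
Hypothesis starK : involutive star.
Hypothesis norm_surj :
  set_surj [set: residue A] (residue_fixed star) (residue_norm star).

Lemma star_unit x : x \is a GRing.unit -> star x \is a GRing.unit.
Proof. exact: rmorph_unit. Qed.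

Lemma half_exists (x : A) : exists2 y, x = y + y & forall s : A,
  star x = s * x -> star y = s * y.
Proof.
exists (x / 2%:R); first by rewrite -mulr2n -[RHS]mulr_natr divrK.
by move=> s e; rewrite rmorphM e rmorphV // rmorph_nat mulrA.
Qed.

(* The root congruent to 1 is unique, hence fixed by the involution. *)
Lemma fixed_sqrt_1D x : r x -> star x = x ->
  exists a, [/\ r a, star a = a & (1 + a) ^+ 2 = 1 + x].
Proof.
move=> rx sx; have [a ra e] := sqrt_1D Acomplete unit2 rx.
exists a; split=> //.
have rsa : r (star a) by apply: maxideal_star.
have u : 2%:R + (a + star a) \is a GRing.unit.
  by apply: unitr_add_maxideal => //; apply: maxidealD.
apply: (mulIr u); apply/eqP; rewrite -subr_eq0; apply/eqP.
have e' : (1 + star a) ^+ 2 = 1 + x.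
  by rewrite -[in RHS]sx -(rmorph1 star) -!rmorphD -rmorphXn e rmorphD rmorph1.
have -> : star a * (2%:R + (a + star a)) - a * (2%:R + (a + star a)) =
  (1 + star a) ^+ 2 - (1 + a) ^+ 2 by ring.
by rewrite e e' subrr.
Qed.

(** A residue with the norm of [w] lifts to [b] with [w = b * star b * (1 + t)], where [t] in [r] is
    fixed by [star]. A fixed root [1 + a] of [1 + t] makes [1 + t] the norm of [1 + a]. *)
Lemma fixed_unit_norm w : w \is a GRing.unit -> star w = w ->
  exists2 b, b \is a GRing.unit & w = b * star b.
Proof.
move=> uw sw.
have [y _ ey] : exists2 y, [set: residue A] y & residue_norm star y = to_residue w.
  apply: norm_surj; rewrite /residue_fixed /=.
  by rewrite residue_involutionE // sw.
pose b := repr y; have yb : to_residue b = y by exact: to_residue_repr.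
have rb : r (w - b * star b).
  apply/to_residueE; rewrite -ey to_residueM yb /residue_norm.
  by rewrite -residue_involutionE // yb.
have un : b * star b \is a GRing.unit.
  have -> : b * star b = w + - (w - b * star b) by ring.
  by apply: unitr_add_maxideal => //; apply: maxidealN.
have ub : b \is a GRing.unit by move: un; rewrite unitrM => /andP[].
pose t := (w - b * star b) / (b * star b).
have st : star t = t.
  rewrite /t rmorphM rmorphV // rmorphB !rmorphM starK sw.
  by rewrite [star b * b]mulrC.
have wt : w = b * star b * (1 + t).
  by rewrite mulrDr mulr1 [t]mulrC mulVKr // addrC subrK.
have [a [ra sa ea]] := fixed_sqrt_1D (maxidealMr _ rb) st.
exists (b * (1 + a)).
  by rewrite unitrM ub /=; apply: unitr_1D.
by rewrite wt -ea rmorphM rmorphD rmorph1 sa; ring.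
Qed.

Section UnimodularForm.
Variables (e : A) (V : lmodType A) (k : hermitian_form star e V).
Hypothesis e1 : e = 1 \/ e = -1.

Lemma sign_star : star e = e.
Proof. by case: e1 => ->; rewrite ?rmorphN rmorph1. Qed.

Lemma sign_sqr : e * e = 1.
Proof. by case: e1 => ->; rewrite ?mulrNN mulr1. Qed.

(** Once some [k v v] is a unit, [k v v / c] is fixed by [star], hence equal to some [b * star b];
    scaling [v] by [b^-1] gives the value [c]. *)
Lemma unimodular_line x y c :
  k x y \is a GRing.unit -> c \is a GRing.unit -> e * star c = c ->
  exists v, k v v = c.
Proof.
move=> uxy uc ec.
have ee := sign_sqr; have se := sign_star.
have sc : star c = e * c by rewrite -[in RHS]ec mulrA ee mul1r.
(* If [k x x] and [k y y] both lie in [r], take [a] with [a * k x y = c / 2]. The cross terms of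
   [x + a *: y] add up to [c], and the other terms lie in [r]. *)
have [v uv] : exists v, k v v \is a GRing.unit.
  have [rx|ux] := maxideal_or_unit Acomplete (k x x); last by exists x.
  have [ry|uy] := maxideal_or_unit Acomplete (k y y); last by exists y.
  have [c' cc' /(_ _ sc) sc'] := half_exists c.
  pose a := c' / k x y.
  exists (x + a *: y); rewrite hformDl !hformDr !hformZl // !hformZr.
  have ac : a * k x y = c' by rewrite divrK.
  have ac2 : star a * k y x = c'.
    by rewrite (hform_sym k x) mulrCA -rmorphM ac sc' mulrA ee mul1r.
  rewrite ac ac2.
  have -> : k x x + c' + (c' + star a * (a * k y y)) =
    c + (k x x + star a * a * k y y) by rewrite cc'; ring.
  by apply: unitr_add_maxideal => //; apply: maxidealD => //; apply: maxidealM.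
have sw : star (k v v) = e * k v v.
  by rewrite [in RHS](hform_sym k v) mulrA ee mul1r.
have sq : star (k v v / c) = k v v / c.
  apply: (mulIr (star_unit uc)).
  by rewrite -rmorphM divrK // sw sc mulrCA divrK.
have [|b ub eb] := fixed_unit_norm _ sq; first by rewrite unitrM uv unitrV.
exists (b^-1 *: v); rewrite hformZl // hformZr.
have usb := star_unit ub.
have -> : k v v = b * star b * c by rewrite -eb divrK.
by rewrite rmorphV // -!mulrA mulKr // mulKr.
Qed.

(** Taking [c = 1] in the second hypothesis forces [e = -1]. Every [k v v] satisfies the excluded
    equation, so it lies in [r]; hence vectors are isotropic modulo [r], and a square root makes one
    of them truly isotropic. *)
Lemma unimodular_hyperbolic x y :
  k x y \is a GRing.unit ->
  (forall c, c \is a GRing.unit -> e * star c <> c) ->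
  exists u v, [/\ k u u = 0, k v v = 0 & k u v = 1].
Proof.
move=> uxy nc; have ee := sign_sqr; have se := sign_star.
have eN1 : e = -1.
  by case: e1 => // e1'; case: (nc 1); rewrite ?unitr1 // rmorph1 mulr1.
have eN z : e * z = - z by rewrite eN1 mulN1r.
have skew v : star (k v v) = - k v v.
  by rewrite [in RHS](hform_sym k v) eN opprK.
have rkvv v : r (k v v).
  have [//|/nc[]] := maxideal_or_unit Acomplete (k v v).
  by rewrite -hform_sym.
have kN u v : k v u = - star (k u v) by rewrite (hform_sym k u) eN.
have isotropic u v : k u v = 1 -> exists2 u', k u' u' = 0 &
    k u' v \is a GRing.unit.
  move=> kuv; have kvu : k v u = - 1 by rewrite kN kuv rmorph1.
  set x1 := k u u; set y1 := k v v.
  have sxy : star (x1 * y1) = x1 * y1 by rewrite rmorphM !skew mulrNN.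
  have [q [rq sq eq]] := fixed_sqrt_1D (maxidealM x1 (rkvv v)) sxy.
  have u1q : 1 + (1 + q) \is a GRing.unit.
    have -> : 1 + (1 + q) = 2%:R + q by ring.
    exact: unitr_add_maxideal.
  (* [1 + q] is the root of [1 + x1 * y1]; the identity [iE] lets [ring] compute with the inverse of
     [1 + (1 + q)]. *)
  pose i := (1 + (1 + q))^-1; have iE : q * i = 1 - i - i.
    rewrite -[1 in RHS](divrr u1q) -/i; ring.
  have si : star i = i.
    by rewrite rmorphV // !rmorphD !rmorph1 sq.
  (* a = - x1 / (1 + sqrt (1 + x1 y1)) is a root of x1 + 2 a - a^2 y1. *)
  pose a := - (x1 * i).
  have sa : star a = - a by rewrite rmorphN rmorphM skew si mulNr.
  exists (u + a *: v).
    rewrite hformDl !hformDr !hformZl // !hformZr kuv kvu sa -/x1 -/y1.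
    have -> : x1 + a * 1 + (- a * -1 + - a * (a * y1)) =
       i ^+ 2 * x1 * ((1 + q) ^+ 2 - (1 + x1 * y1)) by rewrite /a; ring: iE.
    by rewrite eq subrr mulr0.
  rewrite hformDl hformZl // kuv sa.
  apply: unitr_add_maxideal; rewrite ?unitr1 //.
  exact: maxidealM.
have [u ku kuy] : exists2 u', k u' u' = 0 & k u' y \is a GRing.unit.
  have [|u' ? ku'] := isotropic x ((k x y)^-1 *: y).
    by rewrite hformZr mulVr.
  by exists u' => //; move: ku'; rewrite hformZr unitrM => /andP[].
have [v1 kuv1] : exists v1, k u v1 = 1.
  by exists ((k u y)^-1 *: y); rewrite hformZr mulVr.
(* Adding [t *: u] to [v1] changes [k v1 v1] by [- 2 t], and keeps the pairing with [u] because [u]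
   is isotropic. *)
have [t et st] := half_exists (k v1 v1).
have {}st : star t = - t by rewrite -mulN1r; apply: st; rewrite skew mulN1r.
exists u, (v1 + t *: u); split=> //.
  rewrite hformDl !hformDr !hformZl // !hformZr ku kuv1 (kN u v1) kuv1.
  by rewrite rmorph1 st et; ring.
by rewrite hformDr hformZr ku mulr0 addr0.
Qed.
End UnimodularForm.
End Unimodular.

(** * The invariants in adapted coordinates *)

Lemma has_rankP (R : nzRingType) (V : lmodType R) n :
  has_rank V n <-> exists f : {linear V -> 'rV[R]_n}, bijective f.
Proof.
split=> [[[f flin fbij]]|[f fbij]].
  by have [F FE] := exists_linear flin; exists F; apply: eq_bij fbij _ (fsym FE).
by split; exists f => //; exact: linearP.
Qed.

(** The two transition matrices multiply to the identity of size [m], which forces [m <= n]. *)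
Lemma has_rank_le (k : fieldType) (V : lmodType k) m n :
  has_rank V m -> has_rank V n -> (m <= n)%N.
Proof.
move=> /has_rankP[f [f' fK f'K]] /has_rankP[g [g' gK g'K]].
have inv_linear l (a : {linear V -> 'rV[k]_l}) b :
    cancel a b -> cancel b a -> linear b.
  by move=> aK bK c u v; apply: (can_inj aK); rewrite linearP !bK.
have [F FE] := exists_linear (inv_linear _ _ _ fK f'K).
have [G GE] := exists_linear (inv_linear _ _ _ gK g'K).
apply: (@mulmx1_min _ _ _ (lin1_mx (g \o F)) (lin1_mx (f \o G))).
apply/row_matrixP => i; rewrite !rowE mulmxA !mul_rV_lin1 mulmx1 /=.
by rewrite FE GE gK f'K.
Qed.

Lemma dimensionE (k : fieldType) (W : lmodType k) n :
  has_rank W n -> dimension W = n.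
Proof.
move=> Wn; apply: xget_unique => // m Wm; apply/eqP.
by rewrite eqn_leq !(has_rank_le Wm Wn, has_rank_le Wn Wm).
Qed.

Section SubquotientRank.
Variables (A : dvrType) (M : lmodType A) (D : subquot_data M).

(** The first isomorphism theorem, with [f] defined on all of [M] but required to be linear over the
    residue map only on the numerator. *)
Lemma has_rank_subquot n (f : M -> 'rV[residue A]_n) :
    (forall a u v, sq_num D u -> sq_num D v ->
       f (a *: u + v) = to_residue a *: f u + f v) ->
    (forall v, sq_num D v -> f v = 0 <-> sq_den D v) ->
    (forall w, exists2 v, sq_num D v & f v = w) ->
  has_rank (subquot D) n.
Proof.
move=> flin fker fsurj.
have numP (x : num_type D) : sq_num D (val x).
  by have := valP x; rewrite /in_num in_setE.
have fB u v : sq_num D u -> sq_num D v -> f (u - v) = f u - f v.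
  move=> Du Dv; rewrite -scaleN1r addrC flin // addrC.
  have -> : to_residue (-1 : A) = -1 by rewrite /to_residue; exact: rmorphN1.
  by rewrite scaleN1r.
have /submoduleP[_ numlin] := sq_num_submod D.
have numB u v : sq_num D u -> sq_num D v -> sq_num D (u - v).
  by move=> Du Dv; rewrite -scaleN1r addrC; apply: numlin.
pose F (x : subquot D) := f (val (repr x)).
have FE y : F (to_subquot y) = f (val y).
  apply/eqP; rewrite -subr_eq0 -fB //; apply/eqP/fker; first exact: numB.
  by apply/to_subquotE; rewrite to_subquot_repr.
apply/has_rankP.
have [g gE] : exists g : {linear subquot D -> 'rV[residue A]_n}, g =1 F.
  apply: exists_linear => a x y.
  rewrite -[a]to_residue_repr -[x]to_subquot_repr -[y]to_subquot_repr.
  rewrite -[_ *: to_subquot _]/(subquot_scale _ _) subquot_scaleE.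
  by rewrite -to_subquotD !FE flin.
exists g; apply: inj_surj_bijective => [x y|w].
  rewrite !gE -[x]to_subquot_repr -[y]to_subquot_repr !FE => e.
  apply/to_subquotE/fker; first exact: numB.
  by rewrite fB // e subrr.
have [v Dv <-] := fsurj w.
have iv : in_num D v by rewrite /in_num in_setE.
by exists (to_subquot (exist _ v iv)); rewrite gE FE.
Qed.

End SubquotientRank.

Section AdaptedCoordinates.
Variables (A : dvrType) (star : {rmorphism A -> A}) (eps : A).
Notation r := (maxideal A).
Hypothesis starK : involutive star.
Hypothesis epsK : eps * star eps = 1.
Variable p : A.
Hypothesis p0 : p != 0.
Hypothesis rE : forall x, r x <-> exists q, x = p * q.

(** The [c k] are coordinates on the module, and [lev k] is the power of [p] that the form attaches
    to coordinate [k]. [None] marks radical coordinates, which are unconstrained; truncated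
    subtraction makes the condition void when [i <= n]. *)
Definition adapted (X : hspace star eps) (I : finType)
    (lev : I -> option nat) : Prop :=
  exists c : I -> {linear hcar X -> A^o},
    [/\ forall v, (forall k, c k v = 0) -> v = 0,
        forall t : I -> A, exists v, forall k, c k v = t k &
        forall i v, Vfil (hfrm X) i v <->
          forall k n, lev k = Some n -> exists q, c k v = p ^+ (i - n) * q].

Lemma adapted_hiso X Y (I : finType) (lev : I -> option nat) :
  hiso X Y -> adapted Y lev -> adapted X lev.
Proof.
move=> [f [[g fK gK] fiso]] [c [cinj csurj cfil]].
exists (fun k => c k \o f); split=> [v cv0|t|i v].
- by apply: (can_inj fK); rewrite linear0; apply: cinj.
- by have [w cw] := csurj t; exists (g w) => k; rewrite /= gK.
- rewrite -cfil; split=> Vv u; last by rewrite fiso; apply: Vv.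
  by rewrite -[u]gK -fiso; apply: Vv.
Qed.

(* V(i) asks that the coordinates of level n < i lie in r^(i-n), and
   r V(i-1) + V(i+1) asks moreover that those of level i lie in r. *)
Lemma dinv_adapted (X : hspace star eps) (I : finType) (lev : I -> option nat) i :
  adapted X lev -> dinv (hfrm X) i = #|[pred k | lev k == Some i]|.
Proof.
move=> [c [cinj csurj cfil]]; apply: dimensionE.
have surj_r (t : I -> option A) : exists v, forall k,
    c k v = if t k is Some a then a else 0.
  exact: csurj.
pose S := [pred k | lev k == Some i].
pose f v : 'rV[residue A]_#|S| := \row_j to_residue (c (enum_val j) v).
apply: (@has_rank_subquot _ _ _ _ f).
- move=> a u v _ _; apply/rowP => j.
  by rewrite !mxE linearP to_residueD to_residueM.
- move=> v /= Vv; transitivity (forall k, lev k = Some i -> r (c k v)).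
    split=> [fv0 k /eqP lk|rc].
      have Sk : k \in S by [].
      apply/to_residue_eq0.
      have := congr1 (fun z : 'rV_#|S| => z 0 (enum_rank_in Sk k)) fv0.
      by rewrite !mxE enum_rankK_in.
    apply/rowP => j; rewrite !mxE; apply/to_residue_eq0/rc/eqP.
    exact: (enum_valP j).
  split=> [rc|[x [s Hs ->] [y Vy ->]] k lk]; last first.
    rewrite linearD; apply: maxidealD.
      rewrite linear_sum big_seq; elim/big_ind: _ => [||z /Hs[rz _]].
      + exact: maxideal0.
      + exact: maxidealD.
      + by rewrite functionalZ; apply: maxidealMr.
    have /cfil/(_ k i lk)[q ->] := Vy.
    by rewrite subSnn; apply/rE; exists q.
  (* [x] keeps the coordinates of [v] of level below [i]. It will lie in [r V(i-1)], and [v - x] in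
     [V(i+1)]. *)
  have [x xE] := csurj (fun k => if lev k is Some n then
    if (n < i)%N then c k v else 0 else 0).
  exists x; last first.
    exists (v - x); last by rewrite addrC subrK.
    apply/cfil => k n lk; rewrite linearB xE lk.
    case: ltngtP => [ni|ni|ni].
    + by exists 0; rewrite mulr0 subrr.
    + by exists (c k v - 0); rewrite (eqP ni) mul1r.
    + rewrite ni subSnn subr0; apply/rE/rc; rewrite lk ni //.
  (* For [i = 0] no level is smaller, so [x = 0], as [V(-1) = 0] requires. *)
  case: i @S @f Vv rc xE => [|i] S f Vv rc xE /=.
    rewrite [x]cinj; first by exists [::]; rewrite ?big_nil.
    by move=> k; rewrite xE; case: (lev k).
  have /choice[t tE] : forall k, exists q,
      forall n, lev k = Some n -> (n < i.+1)%N -> c k v = p ^+ (i.+1 - n) * q.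
    move=> k; case lk: (lev k) => [n|]; last by exists 0.
    by have /cfil/(_ k n lk)[q e] := Vv; exists q => _ [<-].
  (* [x'] is [x] divided by [p]; one factor [p] is available since only levels at most the new [i]
     occur. *)
  have [x' x'E] := csurj (fun k => if lev k is Some n then
    if (n < i.+1)%N then p ^+ (i - n) * t k else 0 else 0).
  exists [:: (p, x')]; last first.
    rewrite big_seq1 /=; apply/eqP; rewrite -subr_eq0; apply/eqP/cinj => k.
    rewrite linearB functionalZ xE x'E.
    case lk: (lev k) => [n|]; last by rewrite mulr0 subr0.
    case: ifP => ni; last by rewrite mulr0 subr0.
    by rewrite (tE k n lk ni) subSn // exprS mulrA subrr.
  move=> z; rewrite inE => /eqP -> /=; split.
    by apply/rE; exists 1; rewrite mulr1.
  apply/cfil => k n lk; rewrite x'E lk.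
  case: ifP => _; last by exists 0; rewrite mulr0.
  by exists (t k).
- move=> w.
  (* Coordinates of level [i] receive lifts of the entries of [w], all others are zero. *)
  have [v vE] := csurj (fun k =>
    if insub k : {? j | j \in S} is Some u then
    repr (w 0 (enum_rank_in (svalP u) k)) else 0).
  exists v.
    apply/cfil => k n lk; rewrite vE; case: insubP => [u uS uE|_]; last first.
      by exists 0; rewrite mulr0.
    have /eqP : lev k == Some i by exact: uS.
    rewrite lk => -[->]; rewrite subnn.
    by eexists; rewrite mul1r.
  apply/rowP => j; rewrite mxE vE insubT /=; first exact: enum_valP.
  by move=> Sj; rewrite enum_valK_in to_residue_repr.
Qed.

(** Testing [(x, y)] against [(u, 0)] and [(0, u)] shows that [V(i)] of the sum is the product of
    the two [V(i)]. *)
Lemma adapted_hsum X Y (I J : finType) (lev : I -> option nat)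
    (lev' : J -> option nat) :
  adapted X lev -> adapted Y lev' ->
  adapted (hsum X Y)
    (fun k : I + J => match k with inl i => lev i | inr j => lev' j end).
Proof.
move=> [c [cinj csurj cfil]] [d [dinj dsurj dfil]].
have fst_lin : linear (fst : hcar X * hcar Y -> hcar X) by [].
have snd_lin : linear (snd : hcar X * hcar Y -> hcar Y) by [].
have [F FE] := exists_linear fst_lin.
have [G GE] := exists_linear snd_lin.
exists (fun k : I + J => match k with
  | inl i => c i \o F : {linear (hcar X * hcar Y)%type -> A^o}
  | inr j => d j \o G : {linear (hcar X * hcar Y)%type -> A^o}
  end).
split.
- move=> [x y] cd0; congr pair.
    by apply: cinj => k; have := cd0 (inl k); rewrite /= FE.
  by apply: dinj => k; have := cd0 (inr k); rewrite /= GE.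
- move=> t; have [x xE] := csurj (t \o inl); have [y yE] := dsurj (t \o inr).
  by exists (x, y) => -[k|k]; rewrite /= ?FE ?GE.
- move=> i [x y]; split=> [Vxy|cdE u].
    have /cfil cE : Vfil (hfrm X) i x.
      by move=> u; have := Vxy (u, 0); rewrite /= hform0l addr0.
    have /dfil dE : Vfil (hfrm Y) i y.
      by move=> u; have := Vxy (0, u); rewrite /= hform0l add0r.
    by move=> [k|k] n /= lk; rewrite ?FE ?GE; [apply: cE | apply: dE].
  have /cfil Vx : forall k n, lev k = Some n -> exists q, c k x = p ^+ (i - n) * q.
    by move=> k n lk; have := cdE (inl k) n lk; rewrite /= FE.
  have /dfil Vy : forall k n, lev' k = Some n -> exists q, d k y = p ^+ (i - n) * q.
    by move=> k n lk; have := cdE (inr k) n lk; rewrite /= GE.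
  have /submoduleP[_ addI] := ideal_ideal_pow r i.
  by have := addI 1 _ _ (Vx u.1) (Vy u.2); rewrite scale1r.
Qed.

(** For [n <= i] the factor [p ^+ n * c] cancels; for [i < n] both sides hold, the exponent [i - n]
    being 0. *)
Lemma pX_dvd_unit i n c x : c \is a GRing.unit ->
  (exists q, p ^+ n * c * x = p ^+ i * q) <-> exists q, x = p ^+ (i - n) * q.
Proof.
move=> uc; have pn j : p ^+ j != 0 by exact: expf_neq0.
have [ni|/ltnW ni] := leqP n i.
  split=> [[q e]|[q ->]].
    exists (q / c); apply: (mulIr uc); apply: (mulfI (pn n)).
    by rewrite -[X in _ = _ * X]mulrA divrK // [RHS]mulrA -exprD subnKC // -e; ring.
  by exists (c * q); rewrite -{2}(subnKC ni) exprD; ring.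
split=> _; first by exists x; rewrite (eqP ni) mul1r.
by exists (p ^+ (n - i) * c * x); rewrite !mulrA -exprD subnKC.
Qed.

Lemma adapted_line n c d (hd : eps * star d = d) :
  c \is a GRing.unit -> d = p ^+ n * c ->
  adapted (Hspace (line_form starK hd)) (fun _ : unit => Some n).
Proof.
move=> uc dE; exists (fun _ => idfun); split=> [v /(_ tt)//|t|i v].
  by exists (t tt) => -[].
split=> [Vv k _ [<-]|/(_ tt n erefl)/(pX_dvd_unit _ _ _ uc)[q e] u].
  apply/(pX_dvd_unit i n v uc)/(ideal_powE _ _ rE).
  by rewrite -dE; have := Vv 1; rewrite /= rmorph1 mul1r.
by apply/(ideal_powE _ _ rE); exists (star u * q); rewrite /= dE -mulrA e; ring.
Qed.

Lemma adapted_null (hd : eps * star 0 = 0) :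
  adapted (Hspace (line_form starK hd)) (fun _ : unit => None).
Proof.
exists (fun _ => idfun); split=> [v /(_ tt)//|t|i v].
  by exists (t tt) => -[].
split=> // _ u; apply/(ideal_powE _ _ rE).
by exists 0; rewrite /= mulr0 mul0r mulr0.
Qed.

(** Pairing with the two basis vectors reads off the coordinates up to the factors [p ^+ n] and
    [eps * s * p ^+ n]. These differ by a unit, so both coordinates have level [n]. *)
Lemma adapted_hyperbolic n s : s \is a GRing.unit -> star (p ^+ n) = s * p ^+ n ->
  adapted (Hspace (hyperbolic_form starK epsK (p ^+ n))) (fun _ : bool => Some n).
Proof.
move=> us sp.
have ues : eps * s \is a GRing.unit.
  by rewrite unitrM us andbT; apply/unitrP; exists (star eps); rewrite mulrC.
have fst_lin : linear (fst : A^o * A^o -> A^o) by [].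
have snd_lin : linear (snd : A^o * A^o -> A^o) by [].
have [F FE] := exists_linear fst_lin.
have [G GE] := exists_linear snd_lin.
exists (fun b : bool => if b then F else G); split.
- move=> [x y] xy0; have := xy0 true; have := xy0 false.
  by rewrite FE GE /= => -> ->.
- by move=> t; exists (t true, t false) => -[]; rewrite ?FE ?GE.
- move=> i [x y]; split=> [Vv b _ [<-]|fE [a b]].
    case: b; rewrite ?FE ?GE /=.
      apply/(pX_dvd_unit i n x ues)/(ideal_powE _ _ rE).
      have := Vv (0, 1); rewrite /= rmorph0 rmorph1 sp.
      by congr (ideal_pow r i _); ring.
    apply/(pX_dvd_unit i n y (unitr1 _))/(ideal_powE _ _ rE).
    have := Vv (1, 0); rewrite /= rmorph0 rmorph1.
    by congr (ideal_pow r i _); ring.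
  have := fE true n erefl; have := fE false n erefl; rewrite FE GE /=.
  move=> /(pX_dvd_unit _ _ _ (unitr1 _))[q1 e1] /(pX_dvd_unit _ _ _ ues)[q2 e2].
  apply/(ideal_powE _ _ rE); exists (star a * q1 + star b * q2).
  have -> : p ^+ i * (star a * q1 + star b * q2) =
    star a * (p ^+ i * q1) + star b * (p ^+ i * q2) by ring.
  by rewrite -e1 -e2 /= sp; ring.
Qed.

Lemma adapted_zero :
  adapted (Hspace (zero_form star eps 'rV[A]_0)) (fun _ : void => None).
Proof.
exists (fun k => match k : void with end); split=> [v _|t|i v].
- exact: thinmx0.
- by exists 0 => -[].
- by split=> [_ []|_ u]; apply/(ideal_powE _ _ rE); exists 0; rewrite mulr0.
Qed.

End AdaptedCoordinates.

(** * Standard forms *)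

Section StarUniformizer.
Variables (A : dvrType) (star : {rmorphism A -> A}).
Notation r := (maxideal A).
Hypothesis Acomplete : adic_complete r.
Hypothesis unit2 : (2%:R : A) \is a GRing.unit.
Hypothesis starK : involutive star.

(** If [star p = u * p], then [p + s * star p = (1 + s * u) * p] is multiplied by [s] under [star],
    for either sign [s]. As [1 + u] and [1 - u] add up to the unit 2, one of them is a unit, and
    that sign yields a uniformizer. *)
Lemma star_uniformizer_exists : exists p s : A,
  [/\ p != 0, forall x, r x <-> exists q, x = p * q, s = 1 \/ s = -1 &
      star p = s * p].
Proof.
have [p p0 rE] := uniformizer_exists A.
have [u su] : exists u, star p = u * p.
  have /rE[u ->] : r (star p).
    by apply: maxideal_star => //; apply/rE; exists 1; rewrite mulr1.
  by exists u; rewrite mulrC.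
suff [s s1 us] : exists2 s : A, s = 1 \/ s = -1 & 1 + s * u \is a GRing.unit.
  have ss : s * s = 1 by case: s1 => ->; rewrite ?mulrNN mulr1.
  have sts : star s = s by case: s1 => ->; rewrite ?rmorphN rmorph1.
  exists ((1 + s * u) * p), s; split=> //.
  - by rewrite mulf_neq0 //; apply: contraTneq us => ->; rewrite unitr0.
  - move=> x; split=> [/rE[q ->]|[q ->]].
      by exists ((1 + s * u)^-1 * q); rewrite mulrCA !mulrA mulVr // mul1r.
    by apply/rE; exists ((1 + s * u) * q); ring.
  - have -> : (1 + s * u) * p = p + s * star p by rewrite su; ring.
    by rewrite rmorphD rmorphM starK sts mulrDr mulrA ss mul1r addrC.
have [r1u|u1u] := maxideal_or_unit Acomplete (1 + u); last first.
  by exists 1; [left | rewrite mul1r].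
exists (-1); first by right.
have -> : 1 + -1 * u = 2%:R + - (1 + u) by ring.
by apply: unitr_add_maxideal => //; apply: maxidealN.
Qed.

End StarUniformizer.

(** * Decomposition into standard summands and recovery of their multiplicities *)

Section Classification.
Variables (A : dvrType) (star : {rmorphism A -> A}) (eps : A).
Notation r := (maxideal A).
Hypothesis Acomplete : adic_complete r.
Hypothesis unit2 : (2%:R : A) \is a GRing.unit.
Hypothesis starK : involutive star.
Hypothesis norm_surj :
  set_surj [set: residue A] (residue_fixed star) (residue_norm star).
Hypothesis eps1 : eps = 1 \/ eps = -1.

Lemma epsK : eps * star eps = 1.
Proof. by rewrite sign_star // sign_sqr. Qed.

Variables (p s : A).
Hypothesis p0 : p != 0.
Hypothesis rE : forall x, r x <-> exists q, x = p * q.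
Hypothesis s1 : s = 1 \/ s = -1.
Hypothesis star_p : star p = s * p.

(* The value is 0 when no unit c satisfies c = eps s^n c^*; the summands of
   level n are then hyperbolic planes. *)
Definition line_coef (n : nat) : A :=
  xget 0 [set d | eps * star d = d /\
                  exists2 c, c \is a GRing.unit & d = p ^+ n * c].

Lemma line_coef_hermitian n : eps * star (line_coef n) = line_coef n.
Proof.
by rewrite /line_coef; case: xgetP => [x _ []|_] //; rewrite rmorph0 mulr0.
Qed.

Lemma zero_hermitian : eps * star 0 = 0.
Proof. by rewrite rmorph0 mulr0. Qed.

(** [None] plays the part of an infinite level: a line in the radical. *)
Definition atom (o : option nat) : hspace star eps :=
  if o is Some n then
    if line_coef n == 0 then Hspace (hyperbolic_form starK epsK (p ^+ n))
    else Hspace (line_form starK (line_coef_hermitian n))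
  else Hspace (line_form starK zero_hermitian).

Definition atom_rank (o : option nat) : nat :=
  if o is Some n then (line_coef n == 0).+1 else 1.

Definition standard (L : seq (option nat)) : hspace star eps :=
  foldr (fun o => hsum (atom o)) (Hspace (zero_form star eps 'rV[A]_0)) L.

Definition standard_rank (L : seq (option nat)) : nat :=
  \sum_(o <- L) atom_rank o.

Lemma star_pX n : star (p ^+ n) = s ^+ n * p ^+ n.
Proof. by rewrite rmorphXn star_p exprMn. Qed.

Lemma sign_pow n : s ^+ n = 1 \/ s ^+ n = -1.
Proof.
elim: n => [|n IHn]; first by left.
by rewrite exprS; case: IHn => ->; case: s1 => ->;
  rewrite ?mulN1r ?mul1r ?opprK; auto.
Qed.

Lemma pX_neq0 n : p ^+ n != 0.
Proof. exact: expf_neq0. Qed.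

Lemma line_coef_unit n : line_coef n != 0 ->
  exists2 c, c \is a GRing.unit & line_coef n = p ^+ n * c.
Proof. by rewrite /line_coef; case: xgetP => [x _ []|_]; rewrite ?eqxx. Qed.

(** A value found by [xget] is [p ^+ n] times a unit, hence nonzero. So 0 can only be the default,
    and a unit [c] satisfying the equation would make [p ^+ n * c] a candidate. *)
Lemma line_coef_eq0 n c : line_coef n == 0 -> c \is a GRing.unit ->
  eps * s ^+ n * star c <> c.
Proof.
rewrite /line_coef; case: xgetP => [x -> [_ [u uu ->]]|nex _ uc e].
  rewrite mulf_eq0 (negPf (pX_neq0 n)) /= => /eqP u0.
  by move: uu; rewrite u0 unitr0.
apply: (nex (p ^+ n * c)); split; last by exists c.
by rewrite rmorphM star_pX -[in RHS]e; ring.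
Qed.

(** All axioms follow by cancelling [p ^+ n]; the sign picks up [s ^+ n] because [star] multiplies
    [p ^+ n] by it. *)
Lemma divided_form (V : lmodType A) (h : hermitian_form star eps V) n :
  (forall x y, exists q, h x y = p ^+ n * q) ->
  exists k : hermitian_form star (eps * s ^+ n) V,
    forall x y, h x y = p ^+ n * k x y.
Proof.
move=> hdiv; have pn := pX_neq0 n.
have /choice[K KE] : forall x, exists f, forall y, h x y = p ^+ n * f y.
  by move=> x; have /choice[f fE] := hdiv x; exists f.
suff [K1 K2 K3 K4] : [/\ forall u v w, K (u + v) w = K u w + K v w,
    forall u v w, K u (v + w) = K u v + K u w,
    forall a u v, K u (a *: v) = a * K u v &
    forall u v, K v u = eps * s ^+ n * star (K u v)].
  by exists (HermitianForm K1 K2 K3 K4) => x y; rewrite -KE.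
split=> [u v w|u v w|a u v|u v]; apply: (mulfI pn).
- by rewrite mulrDr -!KE hformDl.
- by rewrite mulrDr -!KE hformDr.
- by rewrite mulrCA -!KE hformZr.
- by rewrite -KE (hform_sym h u) KE rmorphM star_pX; ring.
Qed.

(** Strong induction on the rank: a zero form loses a null line, any other form loses the atom of
    its least level [n]. That atom depends on [n] alone, not on [h]. *)
Lemma classification m (h : hermitian_form star eps 'rV[A]_m) :
  exists2 L, standard_rank L = m & hiso (Hspace h) (standard L).
Proof.
elim/ltn_ind: m => m IHm in h *.
have step o m' (h' : hermitian_form star eps 'rV[A]_m') :
    m = (atom_rank o + m')%N -> (0 < atom_rank o)%N ->
    hiso (Hspace h) (hsum (atom o) (Hspace h')) ->
    exists2 L, standard_rank L = m & hiso (Hspace h) (standard L).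
  move=> em o0 hh'.
  have [|L eL hL] := IHm m' _ h'.
    by rewrite em -[X in (X < _)%N]add0n ltn_add2r.
  exists (o :: L); first by rewrite /standard_rank big_cons -/(standard_rank L) eL.
  by apply: (hiso_trans hh'); apply: hsum_hiso.
have [h0|] := pselect (forall x y, h x y = 0).
  case: m IHm h step h0 => [|m] IHm h step h0.
    exists [::]; first by rewrite /standard_rank big_nil.
    by apply: (@hform_equivI _ _ _ _ _ _ _ id) => //; exists id.
  pose v : 'rV[A]_m.+1 := delta_mx 0 0.
  have [f fE] : exists f : {linear 'rV[A]_m.+1 -> A^o}, f =1 fun x => x 0 0.
    by apply: exists_linear => a x y; rewrite !mxE.
  have fv : f v = 1 by rewrite fE mxE !eqxx.
  have [m' [em [h' hh']]] : exists m', m.+1 = m'.+1 /\ exists h' :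
      hermitian_form star eps 'rV[A]_m',
      hiso (Hspace h) (hsum (Hspace (line_form starK zero_hermitian)) (Hspace h')).
    apply: (split_line Acomplete starK (v := v) (f := f)) => // x.
    by rewrite h0 mul0r.
  exact: (step None _ h').
move=> /existsNP[x0 /existsNP[y0 /eqP hxy0]].
have [n0 [c0 uc0 e0]] := unit_part Acomplete rE hxy0.
have exn : exists n, `[< exists x y,
    exists2 c, c \is a GRing.unit & h x y = p ^+ n * c >].
  by exists n0; apply/asboolP; exists x0, y0, c0.
(* Minimality of [n] makes every value divisible by [p ^+ n], while the quotient form still takes a
   unit value. *)
case: (ex_minnP exn) => n /asboolP[x [y [c uc hxy]]] min_n.
have pn := pX_neq0 n.
have hdiv u v : exists q, h u v = p ^+ n * q.
  have [->|huv] := eqVneq (h u v) 0; first by exists 0; rewrite mulr0.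
  have [n' [c' uc' e']] := unit_part Acomplete rE huv.
  have nn' : (n <= n')%N by apply: min_n; apply/asboolP; exists u, v, c'.
  by exists (p ^+ (n' - n) * c'); rewrite mulrA -exprD subnKC.
have [k kE] := divided_form hdiv.
have e1 : eps * s ^+ n = 1 \/ eps * s ^+ n = -1.
  by case: eps1 => ->; case: (sign_pow n) => ->; rewrite ?mulN1r ?mul1r ?opprK; auto.
have kxy : k x y \is a GRing.unit.
  by have -> : k x y = c by apply: (mulfI pn); rewrite -kE.
have [d0|d0] := boolP (line_coef n == 0).
  have nc c' : c' \is a GRing.unit -> eps * s ^+ n * star c' <> c'.
    exact: line_coef_eq0.
  have [u [v [ku kv kuv]]] := unimodular_hyperbolic Acomplete unit2 starK e1 kxy nc.
  have [m' [em [h' hh']]] : exists m', m = m'.+2 /\ exists h' :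
      hermitian_form star eps 'rV[A]_m',
      hiso (Hspace h)
        (hsum (Hspace (hyperbolic_form starK epsK (p ^+ n))) (Hspace h')).
    apply: (split_hyperbolic Acomplete starK epsK (u := u) (v := v)) => //.
    (* Here [eps * star (p ^+ n)] is [eps * s ^+ n * p ^+ n], and the sign [eps * s ^+ n] is its own
       inverse. *)
    - move=> z; exists (k v z * (eps * s ^+ n)); rewrite kE star_pX.
      have : eps * s ^+ n * (eps * s ^+ n) = 1 by exact: sign_sqr.
      by move=> e; rewrite -[LHS]mulr1 -e; ring.
    - by rewrite kE ku mulr0.
    - by rewrite kE kv mulr0.
    - by rewrite kE kuv mulr1.
  apply: (step (Some n) _ h'); rewrite /atom_rank /atom d0 //.
have [c' uc' ec'] := line_coef_unit d0.
have [v kv] : exists v, k v v = c'.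
  apply: (unimodular_line Acomplete unit2 starK norm_surj e1 kxy uc').
  apply: (mulfI pn); rewrite -ec' -[in RHS]line_coef_hermitian ec' rmorphM star_pX.
  by ring.
have hv : h v v = line_coef n by rewrite kE kv.
have [f fE] : exists f : {linear 'rV[A]_m -> A^o},
    forall z, h v z = line_coef n * f z.
  apply: exists_quotient_functional => // z; exists (c'^-1 * k v z).
  by rewrite kE ec' -mulrA mulVKr.
have fv : f v = 1 by apply: (mulfI d0); rewrite -fE mulr1.
have [m' [em [h' hh']]] :=
  split_line Acomplete starK (line_coef_hermitian n) hv fE fv.
by apply: (step (Some n) _ h'); rewrite /atom_rank /atom (negPf d0).
Qed.

Lemma atom_adapted o : exists (I : finType) (lev : I -> option nat),
  adapted p (atom o) lev /\
  forall i, #|[pred k | lev k == Some i]| = ((o == Some i) * atom_rank o)%N.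
Proof.
case: o => [n|]; last first.
  exists unit, (fun _ => None); split; first exact: adapted_null.
  by move=> i; rewrite eq_card0.
have card_const (I : finType) i : #|[pred k : I | Some n == Some i]| =
    ((Some n == Some i) * #|I|)%N.
  case: eqVneq => [_|_]; last by rewrite eq_card0.
  by rewrite mul1n; apply: eq_card.
rewrite /atom /atom_rank; have [l0|l0] := boolP (line_coef n == 0).
  exists bool, (fun _ => Some n); split; last first.
    by move=> i; rewrite card_const card_bool.
  apply: (adapted_hyperbolic _ _ _ _ (s := s ^+ n)) => //.
    by case: (sign_pow n) => ->; rewrite ?unitrN unitr1.
  exact: star_pX.
have [c uc lc] := line_coef_unit l0.
exists unit, (fun _ => Some n); split; last first.
  by move=> i; rewrite card_const card_unit.
exact: adapted_line uc lc.
Qed.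

Lemma standard_adapted L : exists (I : finType) (lev : I -> option nat),
  adapted p (standard L) lev /\ forall i, #|[pred k | lev k == Some i]| =
    (atom_rank (Some i) * count_mem (Some i) L)%N.
Proof.
elim: L => [|o L [J [lev' [adJ cardJ]]]].
  exists void, (fun _ => None); split; first exact: adapted_zero.
  by move=> i; rewrite muln0 eq_card0.
have [I [lev [adI cardI]]] := atom_adapted o.
exists (I + J)%type, (fun k => match k with inl i => lev i | inr j => lev' j end).
split=> [|i]; first exact: adapted_hsum.
rewrite -sum1_card big_sumType /= !sum1_card cardI cardJ mulnDr; congr addn.
by case: eqVneq => [->|_]; rewrite ?muln0 // mulnC.
Qed.

Lemma dinv_standard (V : lmodType A) (h : hermitian_form star eps V) L i :
  hiso (Hspace h) (standard L) ->
  dinv h i = (atom_rank (Some i) * count_mem (Some i) L)%N.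
Proof.
move=> hL; have [I [lev [ad <-]]] := standard_adapted L.
by apply: (dinv_adapted rE (X := Hspace h)); apply: adapted_hiso hL ad.
Qed.

Lemma atom_rank_gt0 o : (0 < atom_rank o)%N.
Proof. by case: o. Qed.

(** Atom ranks are positive and cancel, so finite levels have equal multiplicities. Each [None] has
    rank 1, so the number of these is what remains of the total rank. *)
Lemma standard_perm L L' : standard_rank L = standard_rank L' ->
  (forall i, atom_rank (Some i) * count_mem (Some i) L =
             atom_rank (Some i) * count_mem (Some i) L')%N ->
  perm_eq L L'.
Proof.
move=> rk cnt.
have cntS i : count_mem (Some i) L = count_mem (Some i) L'.
  by apply/eqP; rewrite -(eqn_pmul2l (atom_rank_gt0 (Some i))) cnt.
have permS : perm_eq (filter isSome L) (filter isSome L').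
  apply/allP => -[i|] _; rewrite /= !count_filter; last first.
    by rewrite !(@eq_count _ _ pred0) ?count_pred0 // => -[].
  have cE l : count (predI (pred1 (Some i)) isSome) l = count_mem (Some i) l.
    by apply: eq_count => -[j|] //=; rewrite andbT.
  by rewrite !cE cntS.
have cntN l : (standard_rank l = \sum_(o <- filter isSome l) atom_rank o
    + count_mem None l)%N.
  rewrite /standard_rank (bigID isSome) big_filter /=; congr addn.
  by rewrite -sum1_count; apply: eq_big => -[].
apply/allP => -[i|] _; rewrite /= ?cntS //.
by move: rk; rewrite !cntN (perm_big _ permS) => /addnI ->.
Qed.

End Classification.

Theorem theorem6 (A : dvrType) (star : {rmorphism A -> A}) (eps : A) (m : nat)
    (V V' : lmodType A)
    (h : hermitian_form star eps V) (h' : hermitian_form star eps V') :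
  adic_complete (maxideal A) ->
  (2%:R : A) \is a GRing.unit ->
  involutive star ->
  set_surj [set: residue A] (residue_fixed star) (residue_norm star) ->
  eps = 1 \/ eps = -1 ->
  (0 < m)%N ->
  has_rank V m ->
  has_rank V' m ->
  hform_equiv h h' <-> (forall i : nat, dinv h i = dinv h' i).
Proof.
move=> Ac u2 starK nsurj eps1 _ Vm V'm.
have [p [s [p0 rE s1 sp]]] := star_uniformizer_exists Ac u2 starK.
(* A choice of basis carries the form to row vectors, where [classification] applies. *)
have classify (U : lmodType A) (k : hermitian_form star eps U) :
    has_rank U m -> exists2 L, standard_rank star eps p L = m &
      hiso (Hspace k) (standard starK eps1 p L).
  move=> /has_rankP[f [g fK gK]].
  have g_lin : linear g by move=> a u v; apply: (can_inj fK); rewrite linearP !gK.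
  have [G GE] := exists_linear g_lin.
  have [L rkL kL] := classification Ac u2 starK nsurj eps1 p0 rE s1 sp
    (pullback_form k G).
  exists L => //; apply: (hiso_trans _ kL); exists f; split; first by exists g.
  by move=> u v; rewrite /= !GE !fK.
have [L rkL hL] := classify V h Vm; have [L' rkL' hL'] := classify V' h' V'm.
have dE := dinv_standard p0 rE s1 sp; split=> [hh' i|dh].
  (* Composing with the equivalence makes the standard form of [h'] one for [h] too, so both
     invariants are read from [L']. *)
  rewrite (dE _ _ _ _ _ _ _ hL') (dE _ _ _ _ _ _ _ (hiso_trans _ hL')) //.
have LL' : perm_eq L L'.
  apply: (standard_perm (star := star) (eps := eps) (p := p)).
    by rewrite rkL rkL'.
  by move=> i; rewrite -(dE _ _ _ _ _ _ _ hL) -(dE _ _ _ _ _ _ _ hL').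
suff: hiso (Hspace h) (Hspace h') by [].
apply: (hiso_trans hL); apply: (hiso_trans _ (hiso_sym hL')).
exact: hsum_seq_perm.
Qed.
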